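(* For every finite simple graph $H$ with $e(H)\ge 1$ there exist constants $c,\gamma>0$ (depending only on $H$) such that, for all sufficiently large $n$ and every integer $b\ge 1$ with $b\le c\,n^{1/m(H)}$, in the $b$-Waiter-Client game on $K_n$ Waiter has a strategy which, no matter how Client plays, ensures that the resulting graph $G$ contains at least $\gamma\, n^{v(H)}/b^{e(H)}$ copies of $H$.
   Context: For a graph $H$, $v(H)$ and $e(H)$ denote its numbers of vertices and edges, and $$m(H)=\max\left\{\frac{e(H')}{v(H')}\colon H'\subseteq H,\ v(H')\ge 1\right\},$$ where the maximum is over subgraphs $H'$ of $H$. The $b$-Waiter-Client game on $K_n$ (the complete graph on $n$ vertices) is the following two-player perfect-information game. It starts with the empty graph $G$ on the vertex set of $K_n$. In each round, the first player, Waiter, chooses $b$ distinct edges of $K_n$ which have not previously been chosen by Waiter in any earlier round; the second player, Client, then immediately and irrevocably picks one of these $b$ edges and adds it to $G$. The other $b-1$ edges are discarded (they cannot be offered again). The game ends when fewer than $b$ edges of $K_n$ remain unoffered; the resulting graph is $G$ at the end of the game. A copy of $H$ in $G$ is a (not necessarily induced) subgraph of $G$ isomorphic to $H$. ''For all sufficiently large $n$'' means that there is $n_0$ depending only on $H$ such that the assertion holds for all $n\ge n_0$ and all admissible $b$. *)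

(* Defs.v *)
From HB Require Import structures.
From mathcomp Require Import all_boot all_order all_algebra.
From mathcomp Require Import reals exp.

Set Implicit Arguments.
Unset Strict Implicit.
Unset Printing Implicit Defensive.

Import Order.TTheory GRing.Theory Num.Theory.

(* A simple graph on a finite type T has vertex set the whole of T and is given
   by its edge set, a set of two-element subsets of T. *)
Definition simple_graph (T : finType) (E : {set {set T}}) : bool :=
  [forall e in E, #|e| == 2].

Definition Kn_edges (n : nat) : {set {set 'I_n}} :=
  [set e : {set 'I_n} | #|e| == 2].

(* S = (V', E') is a (not necessarily induced) subgraph of (T, E). *)
Definition subgraph (T : finType) (E : {set {set T}})
    (S : {set T} * {set {set T}}) : bool :=
  (S.2 \subset E) && [forall e in S.2, e \subset S.1].

(* The default value 0 does not affect the maximum when T is nonempty: all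
   ratios are nonnegative. *)
Definition max_density (R : realType) (T : finType) (E : {set {set T}}) : R :=
  (\big[Num.max/0]_(S : {set T} * {set {set T}} |
       subgraph E S && (0 < #|S.1|)%N) (#|S.2|%:R / #|S.1|%:R))%R.

Definition isomorphic_to (T U : finType) (E : {set {set T}})
    (S : {set U} * {set {set U}}) : bool :=
  [exists f : {ffun T -> U},
    [&& injectiveb f,
        f @: [set: T] == S.1 &
        [set f @: (e : {set T}) | e in E] == S.2]].

(* Copies are subgraphs, recorded with their vertex sets so that isolated
   vertices of (T, E) are accounted for; embeddings with the same image are not
   counted separately. *)
Definition copies (T U : finType) (E : {set {set T}}) (G : {set {set U}}) : nat :=
  #|[set S : {set U} * {set {set U}} | subgraph G S && isomorphic_to E S]|.

Section Game.
Variables b n : nat.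

(* The rounds played so far, in chronological order: the set of edges offered
   by Waiter and the edge picked by Client. *)
Definition history : Type := seq ({set {set 'I_n}} * {set 'I_n}).

Definition unoffered (h : history) : {set {set 'I_n}} :=
  Kn_edges n :\: \bigcup_(r <- h) r.1.

Definition client_graph (h : history) : {set {set 'I_n}} :=
  [set e in [seq r.2 | r <- h]].

Definition game_over (h : history) : bool := #|unoffered h| < b.

Definition waiter_strategy : Type := history -> {set {set 'I_n}}.

(* The histories that can arise when Waiter follows s and Client picks
   arbitrarily among the offered edges. *)
Inductive play (s : waiter_strategy) : history -> Prop :=
| play_start : play s [::]
| play_round (h : history) (e : {set 'I_n}) :
    play s h -> ~~ game_over h -> e \in s h -> play s (rcons h (s h, e)).

Definition legal_strategy (s : waiter_strategy) : Prop :=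
  forall h : history, play s h -> ~~ game_over h ->
    s h \subset unoffered h /\ #|s h| = b.

Definition waiter_ensures (P : {set {set 'I_n}} -> Prop) : Prop :=
  exists s : waiter_strategy, legal_strategy s /\
    forall h : history, play s h -> game_over h -> P (client_graph h).

End Game.

(* Main.v *)
Require Import Defs.
From HB Require Import structures.
From mathcomp Require Import all_boot all_order all_algebra.
From mathcomp Require Import boolp reals exp.
From mathcomp Require Import lra ring.

Set Implicit Arguments.
Unset Strict Implicit.
Unset Printing Implicit Defensive.

Import Order.TTheory GRing.Theory Num.Theory.
Local Open Scope ring_scope.

(* Candidates for copies of H are the maps phi sending each vertex t of H into
   its own class of q ~ n / v(H) vertices of K_n; the pairs of K_n reached from
   different edges of H are then distinct. Waiter treats the edges e of H in
   successive stages, keeping a family F of candidates all of whose treated edges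
   were picked, together with upper bounds D(K) on the number of members of F
   that agree with a given one on a vertex set K.

   In the stage of e, Waiter offers the b unoffered pairs with the most live
   candidates. Since the pick is at least as good as whatever remains, about
   |F| / b candidates survive, up to the loss b * D(e) caused by the first group.
   To keep degrees bounded, a candidate is dead once, for some K, the number of
   survivors agreeing with it on K exceeds 2^v(H) D(K) / b; double counting shows
   that few die. The new bound is 2^v(H) D(K) / b + D(K :|: e), the second term
   being the overshoot of a single pick. Unfolding this recursion, b * D(e) is
   small compared with |F| exactly because b^e(H') <= c n^v(H') for every
   subgraph H' with at least one edge, which is what b <= c n^(1/m(H)) says. *)

(** * Forced positions and strategies *)

(** A derivation is a well-founded tree of offers. It may stop before the game does, so plans for
    successive stages can be chained without naming a strategy. *)
Inductive forces (b n : nat) (Q : history n -> Prop) : history n -> Prop :=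
| forces_now h : Q h -> forces b Q h
| forces_offer h (A : {set {set 'I_n}}) : A \subset unoffered h -> #|A| = b ->
    (forall e, e \in A -> forces b Q (rcons h (A, e))) -> forces b Q h.

Lemma forces_trans b n (Q Q' : history n -> Prop) h :
  forces b Q h -> (forall h', Q h' -> forces b Q' h') -> forces b Q' h.
Proof.
move=> + QQ'; elim=> [{}h /QQ'//|{}h A Asub Ab _ IH].
exact: forces_offer Asub Ab _.
Qed.

Lemma unoffered_rcons n (h : history n) A e :
  unoffered (rcons h (A, e)) = unoffered h :\: A.
Proof. by rewrite /unoffered big_rcons /= setDDl. Qed.

Lemma client_graph_rcons n (h : history n) A e :
  client_graph (rcons h (A, e)) = e |: client_graph h.
Proof. by apply/setP=> f; rewrite !inE map_rcons mem_rcons in_cons. Qed.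

(** Choice extracts an offer at each forced unfinished position, and induction along [play] keeps
    positions forced. Once fewer than [b] pairs remain no offer is possible, so the derivation must
    end with [forces_now]. *)
Lemma forces_ensures b n (P : {set {set 'I_n}} -> Prop) :
  forces b (fun h => game_over b h /\ P (client_graph h)) [::] ->
  @waiter_ensures b n P.
Proof.
set Q := (Q in forces b Q _) => Q0.
have /choice[s sP] (h : history n) : exists A : {set {set 'I_n}},
    forces b Q h -> ~~ game_over b h ->
    [/\ A \subset unoffered h, #|A| = b &
        forall e, e \in A -> forces b Q (rcons h (A, e))].
  have [[Qh ngo]|nQ] := pselect (forces b Q h /\ ~~ game_over b h).
    case: Qh ngo => {}h.
      by case=> ->.
    by move=> A ? ? ? ngo; exists A.
  by exists set0 => ? ?; case: nQ.
have playQ h : play b s h -> forces b Q h.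
  elim=> // {}h e _ Qh ngo es.
  by have [_ _] := sP h Qh ngo; apply.
exists s; split=> [h /playQ Qh ngo|h /playQ]; first by have [] := sP h Qh ngo.
case=> [{}h [] //|{}h A Asub <- _].
by rewrite /game_over ltnNge subset_leq_card.
Qed.

(** Arbitrary offers run the game to its end, and a monotone goal survives because Client's graph
    only grows. *)
Lemma forces_finish b n (P : {set {set 'I_n}} -> Prop) (h : history n) :
  (0 < b)%N -> (forall G G' : {set {set 'I_n}}, G \subset G' -> P G -> P G') ->
  P (client_graph h) ->
  forces b (fun h => game_over b h /\ P (client_graph h)) h.
Proof.
move=> b0 Pmono.
have [k] := ubnP #|unoffered h|; elim: k h => // k IH h kh Ph.
have [go|] := boolP (game_over b h); first exact: forces_now.
rewrite /game_over -leqNgt => bh.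
have [A Asub Ab] : exists2 A : {set {set 'I_n}}, A \subset unoffered h & #|A| = b.
  have : (0 < #|[set A : {set {set 'I_n}} | A \subset unoffered h & #|A| == b]|)%N.
    by rewrite cards_draws bin_gt0.
  by case/card_gt0P=> A; rewrite inE => /andP[? /eqP ?]; exists A.
apply: (forces_offer Asub Ab) => e eA; apply: IH.
  rewrite unoffered_rcons -ltnS; apply: leq_trans kh.
  rewrite !ltnS cardsD (setIidPr Asub) Ab ltn_subrL b0 /=.
  by rewrite (leq_trans b0 bh).
by rewrite client_graph_rcons; apply: Pmono Ph; apply: subsetUr.
Qed.

(** * Heavy pairs and dead candidates *)

Lemma top_subset (R : realType) (T : finType) (w : T -> R) (U : {set T}) k :
  (k <= #|U|)%N -> exists A : {set T}, [/\ A \subset U, #|A| = k &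
    forall x y, x \in A -> y \in U :\: A -> w y <= w x].
Proof.
elim: k U => [|k IH] U kU.
  by exists set0; split; rewrite ?sub0set ?cards0// => x y; rewrite inE.
have [x0 x0U] : exists x, x \in U by apply/card_gt0P; apply: leq_trans kU.
have [x xU xmax] := arg_maxP w x0U.
have [|A [AU Ak Amax]] := IH (U :\ x).
  by rewrite (cardsD1 x U) (xU : x \in U) in kU.
have xA : x \notin A by apply/negP => /(subsetP AU); rewrite !inE eqxx.
exists (x |: A); split.
- by rewrite subUset sub1set (xU : x \in U) (subset_trans AU)// subsetDl.
- by rewrite cardsU1 xA Ak.
- move=> y z; rewrite !inE negb_or => /orP[/eqP-> /andP[_ zU]|yA /andP[/andP[zx zA] zU]].
    exact: xmax.
  by apply: Amax; rewrite // !inE zx zA.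
Qed.

Lemma double_count (I J : finType) (A : {set I}) (B : {set J}) (r : I -> J -> bool) :
  (\sum_(i in A) #|[set j in B | r i j]| = \sum_(j in B) #|[set i in A | r i j]|)%N.
Proof.
under eq_bigr do rewrite -sum1_card big_set big_mkcondr /=.
rewrite exchange_big /=; apply: eq_bigr => j _.
by rewrite -sum1_card big_set big_mkcondr.
Qed.

(** The dead candidates of the overview, for survivors [A]. The factor [#|I|] in the threshold pays
    for a union bound over [k]. *)
Definition saturated (R : realType) (b : nat) (Phi I : finType) (rl : I -> rel Phi)
    (D : I -> R) (A : {set Phi}) : {set Phi} :=
  [set phi | [exists k, #|I|%:R * D k < b%:R * #|[set psi in A | rl k phi psi]|%:R]].

Lemma saturatedS (R : realType) b (Phi I : finType) (rl : I -> rel Phi) (D : I -> R)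
    (A B : {set Phi}) :
  A \subset B -> saturated b rl D A \subset saturated b rl D B.
Proof.
move=> AB; apply/subsetP=> phi; rewrite !inE => /existsP[k lt].
apply/existsP; exists k; apply: lt_le_trans lt _.
rewrite ler_wpM2l// ler_nat subset_leq_card//.
by apply/subsetP=> psi; rewrite !inE => /andP[/(subsetP AB)-> ->].
Qed.

(** For fixed [k], count related pairs of a [phi] in [F] over the threshold and a [psi] in [A]. Each
    such [phi] is in more than $|I| D(k)/b$ of them and each [psi] in at most $D(k)$, so at most
    $b|A|/|I|$ such [phi] exist. Summing over [k] gives the bound. *)
Lemma card_saturated (R : realType) b (Phi I : finType) (rl : I -> rel Phi)
    (D : I -> R) (F A : {set Phi}) :
  (forall k, symmetric (rl k)) -> (forall k, 0 < D k) ->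
  (forall k phi, #|[set psi in F | rl k phi psi]|%:R <= D k) ->
  #|F :&: saturated b rl D A|%:R <= b%:R * #|A|%:R :> R.
Proof.
move=> rlC D0 degF.
have [I0|I0] := posnP #|I|.
  rewrite (_ : _ :&: _ = set0) ?cards0 ?mulr_ge0//.
  apply/setP=> phi; rewrite !inE; apply/negP=> /andP[_ /existsP[k _]].
  by move: (card0_eq I0 k); rewrite !inE.
pose S k := [set phi in F | #|I|%:R * D k < b%:R * #|[set psi in A | rl k phi psi]|%:R].
have SE : F :&: saturated b rl D A = \bigcup_(k : I) S k.
  apply/setP=> phi; rewrite !inE; apply/andP/bigcupP.
    by case=> Fphi /existsP[k lt]; exists k; rewrite // inE Fphi.
  by case=> k _; rewrite inE => /andP[-> lt]; split=> //; apply/existsP; exists k.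
have Sk k : #|I|%:R * #|S k|%:R <= b%:R * #|A|%:R :> R.
  rewrite -(ler_pM2r (D0 k)).
  apply: le_trans (_ : \sum_(phi in S k) b%:R * #|[set psi in A | rl k phi psi]|%:R <= _).
    rewrite mulrAC mulr_natr -sumr_const; apply: ler_sum => phi.
    by rewrite inE => /andP[_ /ltW].
  rewrite -mulr_sumr -mulrA ler_wpM2l// -natr_sum double_count natr_sum.
  rewrite mulr_natl -sumr_const; apply: ler_sum => psi _.
  apply: le_trans (degF k psi); rewrite ler_nat subset_leq_card//.
  by apply/subsetP=> phi; rewrite !inE rlC => /andP[/andP[-> _] ->].
rewrite SE; apply: le_trans (_ : \sum_k #|S k|%:R <= _).
  rewrite -natr_sum ler_nat.
  elim/big_ind2: _ => [|X x Y y Xx Yy|//]; first by rewrite cards0.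
  by rewrite (leq_trans (leq_card_setU _ _)) ?leq_add.
rewrite -(ler_pM2l (_ : 0 < #|I|%:R)) ?ltr0n// mulr_sumr.
apply: le_trans (ler_sum _ (fun k _ => Sk k)) _.
by rewrite sumr_const -[X in X <= _]mulr_natl.
Qed.

(** * One stage of the game *)

(** A potential argument for greedy offers: [U] holds the pairs still to be offered, [A] the
    survivors, and [m] bounds the live weight of every pair in [U]. A round costs at most $bm$, and
    the weight of its pick becomes the next [m]. *)
Lemma forces_stage (R : realType) b n (Phi I : finType) (rl : I -> rel Phi)
    (D D' : I -> R) (M : R) (F : {set Phi}) (eps : Phi -> {set 'I_n})
    (O : {set {set 'I_n}}) (h0 : history n) :
  (0 < b)%N -> (forall k, symmetric (rl k)) -> (forall k, left_transitive (rl k)) ->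
  (forall k, 0 < D k) ->
  (forall k phi, #|[set psi in F | rl k phi psi]|%:R <= D k) ->
  (forall k, 0 <= D' k) ->
  (forall k phi e, #|[set psi in F | rl k phi psi && (eps psi == e)]|%:R <= D' k) ->
  (forall e, #|[set psi in F | eps psi == e]|%:R <= M) ->
  O \subset unoffered h0 -> (forall phi, eps phi \in O) ->
  forces b (fun h => [/\ client_graph h0 \subset client_graph h,
      unoffered h0 :\: O \subset unoffered h &
      exists A : {set Phi},
        [/\ A \subset F, forall phi, phi \in A -> eps phi \in client_graph h,
            forall k phi, #|[set psi in A | rl k phi psi]|%:R
               <= #|I|%:R * D k / b%:R + D' k &
            #|F|%:R <= 2 * b%:R * #|A|%:R + b%:R * M]]) h0.
Proof.
move=> b0 rlC rlT D0 degF D'0 degF' degM Oun epsO.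
have b0R : 0 < b%:R :> R by rewrite ltr0n.
pose sat := saturated b rl D.
pose live A e := [set phi in F | (eps phi == e) && (phi \notin sat A)].
pose w A e : R := #|live A e|%:R.
(* Candidates still in play, together with the dead ones; a round removes at most the live weight of
   the offered pairs. *)
pose X A (U : {set {set 'I_n}}) := [set phi in F | (eps phi \in U) || (phi \in sat A)].
set Q := (Q in forces b Q _).
suff main (U : {set {set 'I_n}}) (A : {set Phi}) (h : history n) (m : R) :
    A \subset F -> (forall phi, phi \in A -> eps phi \in client_graph h) ->
    (forall phi, phi \in A -> eps phi \notin U) ->
    U \subset O -> U \subset unoffered h ->
    unoffered h0 :\: O \subset unoffered h ->
    client_graph h0 \subset client_graph h -> 0 <= m ->
    (forall e, e \in U -> w A e <= m) ->
    (* The summand [b * m] pays for the next pick, which gains at least the weight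
       of every pair remaining after it. *)
    #|F|%:R + b%:R * m <= #|X A U|%:R + b%:R * #|A|%:R + b%:R * M ->
    (forall k phi, #|[set psi in A | rl k phi psi]|%:R
               <= #|I|%:R * D k / b%:R + D' k) ->
    forces b Q h.
  apply: (main O set0 h0 M) => //.
  - exact: sub0set.
  - by move=> phi; rewrite inE.
  - by move=> phi; rewrite inE.
  - exact: subsetDl.
  (* [M] is nonnegative because it bounds a cardinal, whatever the pair. *)
  - by apply: le_trans (degM set0).
  - move=> e _; apply: le_trans (degM e); rewrite ler_nat subset_leq_card//.
    by apply/subsetP=> phi; rewrite !inE => /and3P[-> ->].
  - rewrite cards0 mulr0 addr0 lerD2r ler_nat subset_leq_card//.
    by apply/subsetP=> phi Fphi; rewrite inE Fphi epsO.
  - move=> k phi; rewrite (_ : [set _ | _] = set0) ?cards0.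
      by rewrite addr_ge0// divr_ge0// mulr_ge0// ltW.
    by apply/setP=> psi; rewrite !inE.
have [N] := ubnP #|U|; elim: N U A h m => // N IH U A h m UN.
move=> AF Ah AU UO Uh unh clh m0 wm cnt degA.
have [Ub|bU] := ltnP #|U| b.
  apply: forces_now; split=> //; exists A; split=> //.
  (* Fewer than [b] pairs remain, each of live weight at most [m], and at most $b|A|$ candidates are
     dead. *)
  have mb : #|X A U|%:R <= b%:R * m + b%:R * #|A|%:R.
    apply: le_trans (_ : \sum_(e in U) w A e + #|F :&: sat A|%:R <= _).
      rewrite -natr_sum -natrD ler_nat.
      apply: leq_trans (_ : #|\bigcup_(e in U) live A e :|: (F :&: sat A)| <= _)%N.
        apply/subset_leq_card/subsetP=> phi; rewrite [_ \in X _ _]in_set => /andP[Fphi].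
        rewrite in_setU in_setI Fphi /=.
        case: (boolP (phi \in sat A)) => [|ns]; rewrite ?orbT ?orbF// => U'.
        by apply/bigcupP; exists (eps phi); rewrite // in_set Fphi eqxx.
      apply: leq_trans (leq_card_setU _ _) _; rewrite leq_add2r.
      elim/big_ind2: _ => [|Z x Y y Zx Yy|//]; first by rewrite cards0.
      by rewrite (leq_trans (leq_card_setU _ _)) ?leq_add.
    apply: lerD; last exact: card_saturated.
    apply: le_trans (ler_sum _ wm) _; rewrite sumr_const -[X in X <= _]mulr_natl.
    by rewrite ler_wpM2r// ler_nat ltnW.
  lra.
have [S [SU Sb Smax]] := top_subset (w A) bU.
apply: (forces_offer (A := S)); rewrite ?(subset_trans SU)// => e eS.
have eU := subsetP SU e eS.
apply: (IH (U :\: S) (A :|: live A e) _ (w A e)).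
- rewrite -ltnS; apply: leq_trans UN.
  rewrite !ltnS cardsD (setIidPr SU) Sb ltn_subrL b0 /=.
  by rewrite (leq_trans b0 bU).
- by rewrite subUset AF; apply/subsetP=> phi; rewrite inE => /andP[].
- move=> phi; rewrite client_graph_rcons in_setU [_ \in live _ _]in_set in_setU1 =>
    /orP[/Ah->|/and3P[_ -> _]//].
  by rewrite orbT.
- move=> phi; rewrite in_setU [_ \in live _ _]in_set in_setD =>
    /orP[/AU/negPf->|/and3P[_ /eqP-> _]]; first by rewrite andbF.
  by rewrite eS.
- by rewrite (subset_trans (subsetDl _ _)).
- by rewrite unoffered_rcons setSD.
- rewrite unoffered_rcons; apply/subsetP=> f fun0.
  apply/setDP; split; first exact: (subsetP unh).
  by case/setDP: fun0 => _; apply: contra; apply/subsetP/(subset_trans SU).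
- by rewrite client_graph_rcons (subset_trans clh)// subsetUr.
- exact: ler0n.
(* More survivors only kill more candidates, so live weights do not grow, and the picked pair was
   among the heaviest. *)
- move=> f fU; apply: le_trans (Smax _ _ eS fU).
  rewrite ler_nat subset_leq_card//; apply/subsetP=> phi.
  rewrite ![_ \in live _ _]in_set => /and3P[-> -> /=].
  by apply: contra; apply: (subsetP (saturatedS _ _ _ _)); apply: subsetUl.
- have disj : [disjoint A & live A e].
    rewrite disjoints_subset; apply/subsetP=> phi /AU; rewrite !inE => phiU.
    by apply: contra phiU => /and3P[_ /eqP->].
  have -> : #|A :|: live A e| = (#|A| + #|live A e|)%N.
    by apply/eqP; rewrite (leq_card_setU A (live A e)).2.
  have XX : #|X A U|%:R <= #|X (A :|: live A e) (U :\: S)|%:R + b%:R * m.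
    apply: le_trans (_ : #|X (A :|: live A e) (U :\: S)|%:R + \sum_(f in S) w A f <= _).
      rewrite -natr_sum -natrD ler_nat.
      apply: leq_trans (_ : #|X (A :|: live A e) (U :\: S) :|: \bigcup_(f in S) live A f| <= _)%N.
        apply/subset_leq_card/subsetP=> phi; rewrite [_ \in X _ _]in_set => /andP[Fphi].
        rewrite in_setU [_ \in X _ _]in_set Fphi /= in_setD.
        case: (boolP (phi \in sat A)) => [sA _|ns].
          by rewrite (subsetP (saturatedS _ _ _ (subsetUl A (live A e))) _ sA) orbT.
        rewrite orbF => U'; rewrite U' andbT.
        case: (boolP (eps phi \in S)) => //= S'; apply/orP; right.
        by apply/bigcupP; exists (eps phi); rewrite // in_set Fphi eqxx.
      apply: leq_trans (leq_card_setU _ _) _; rewrite leq_add2l.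
      elim/big_ind2: _ => [|Z x Y y Zx Yy|//]; first by rewrite cards0.
      by rewrite (leq_trans (leq_card_setU _ _)) ?leq_add.
    rewrite lerD2l; apply: le_trans (ler_sum _ (fun f fS => wm f (subsetP SU f fS))) _.
    by rewrite sumr_const Sb -[X in X <= _]mulr_natl.
  rewrite natrD mulrDr -/(w A e); lra.
- move=> k phi.
  (* If the class of [phi] is over the threshold, transitivity makes all its members dead and none
     joins. Otherwise the old part is within the threshold and one pick adds at most [D' k]. *)
  have [ks|] := ltP (#|I|%:R * D k) (b%:R * #|[set psi in A | rl k phi psi]|%:R).
    rewrite (_ : [set psi in A :|: live A e | rl k phi psi] = [set psi in A | rl k phi psi])//.
    apply/setP=> psi; rewrite inE [RHS]inE in_setU [_ \in live _ _]inE.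
    case: (boolP (rl k phi psi)) => kpsi; rewrite ?andbF ?andbT//.
    suff -> : psi \in sat A by rewrite !andbF orbF.
    rewrite inE; apply/existsP; exists k.
    rewrite (_ : [set psi0 in A | rl k psi psi0] = [set psi in A | rl k phi psi])//.
    by apply/setP=> x; rewrite !inE (rlT _ _ _ kpsi).
  rewrite mulrC -ler_pdivlMr// => kns.
  apply: le_trans (lerD kns (degF' k phi e)).
  rewrite -natrD ler_nat; apply: leq_trans (leq_card_setU _ _).
  apply/subset_leq_card/subsetP=> psi.
  rewrite inE in_setU [_ \in live _ _]inE !inE.
  by case/andP=> /orP[->|/and3P[-> -> _]] ->; rewrite ?orbT.
Qed.

(** * Candidate maps and their images *)

Definition agree (T U : finType) (K : {set T}) : rel {ffun T -> U} :=
  fun phi psi => [forall t in K, phi t == psi t].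

Lemma agreeP (T U : finType) (K : {set T}) (phi psi : {ffun T -> U}) :
  reflect {in K, phi =1 psi} (agree K phi psi).
Proof. exact: 'forall_in_eqP. Qed.

Lemma agree_sym (T U : finType) (K : {set T}) : symmetric (@agree T U K).
Proof.
by move=> phi psi; apply/agreeP/agreeP => H t /H.
Qed.

Lemma agree_left_transitive (T U : finType) (K : {set T}) :
  left_transitive (@agree T U K).
Proof.
move=> phi psi /agreeP pp chi; apply/agreeP/agreeP => H t Kt.
  by rewrite -(pp t Kt) H.
by rewrite (pp t Kt) H.
Qed.

Lemma card_agree (T U : finType) (K : {set T}) (phi : {ffun T -> U}) :
  #|[set psi | agree K phi psi]| = (#|U| ^ (#|T| - #|K|))%N.
Proof.
pose F t : pred U := if t \in K then pred1 (phi t) else predT.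
have -> : #|[set psi | agree K phi psi]| = #|(family F : pred {ffun T -> U})|.
  rewrite cardsE; apply: eq_card => psi; rewrite !inE.
  apply/agreeP/familyP => H t; last by have := H t; rewrite /F => + Kt; rewrite Kt => /eqP.
  by rewrite /F; case: ifP => // Kt; rewrite inE (H t Kt).
rewrite card_family foldrE big_map big_enum /= (bigID [in K]) /=.
rewrite big1 => [|t Kt]; last by rewrite /F Kt card1.
under eq_bigr do rewrite /F ifN//.
rewrite mul1n prod_nat_const -(cardsC K) addKn.
by congr (_ ^ _)%N; apply: eq_card => t; rewrite !inE.
Qed.

Definition embed (T : finType) (q n : nat) (iota : T * 'I_q -> 'I_n)
    (phi : {ffun T -> 'I_q}) (e : {set T}) : {set 'I_n} :=
  [set iota (t, phi t) | t in e].

Lemma card_embed (T : finType) (q n : nat) (iota : T * 'I_q -> 'I_n) phi e :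
  injective iota -> #|embed iota phi e| = #|e|.
Proof. by move=> iota_inj; rewrite card_imset// => t t' /iota_inj[]. Qed.

(** Injectivity of [iota] lets each image vertex reveal both its class [t] and the value there.
    Hence different edges of $H$ never compete for a pair. *)
Lemma embed_eq (T : finType) (q n : nat) (iota : T * 'I_q -> 'I_n) phi psi e e' :
  injective iota -> embed iota phi e = embed iota psi e' -> e = e' /\ agree e phi psi.
Proof.
move=> iota_inj eq.
have H t : t \in e -> t \in e' /\ phi t = psi t.
  move=> te; have : iota (t, phi t) \in embed iota psi e' by rewrite -eq imset_f.
  by case/imsetP=> t' t'e' /iota_inj[-> ->].
split; last by apply/agreeP=> t /H[].
apply/setP=> t; apply/idP/idP => [/H[]//|te'].
have : iota (t, psi t) \in embed iota phi e by rewrite eq imset_f.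
by case/imsetP=> t' t'e /iota_inj[-> _].
Qed.

(** The vertex set of the copy already determines [phi], so no automorphism factor is lost. *)
Lemma leq_copies (T : finType) (q n : nat) (iota : T * 'I_q -> 'I_n)
    (E : {set {set T}}) (G : {set {set 'I_n}}) (F : {set {ffun T -> 'I_q}}) :
  injective iota ->
  (forall phi e, phi \in F -> e \in E -> embed iota phi e \in G) ->
  (#|F| <= copies E G)%N.
Proof.
move=> iota_inj FG.
pose f phi := (embed iota phi [set: T], [set embed iota phi e | e : {set T} in E]).
have f_inj : injective f.
  move=> phi psi [/(embed_eq iota_inj)[_ /agreeP H] _]; apply/ffunP => t.
  by rewrite H.
rewrite -(card_imset _ f_inj); apply/subset_leq_card/subsetP => _ /imsetP[phi Fphi ->].
rewrite inE; apply/andP; split.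
  apply/andP; split=> /=.
    by apply/subsetP=> _ /imsetP[e eE ->]; apply: FG.
  by apply/forall_inP=> _ /imsetP[e eE ->]; rewrite imsetS// subsetT.
apply/existsP; exists [ffun t => iota (t, phi t)]; apply/and3P; split=> /=.
- by apply/injectiveP => t t'; rewrite !ffunE => /iota_inj[].
- by apply/eqP/eq_imset => t; rewrite ffunE.
- by apply/eqP/eq_imset => e; apply: eq_imset => t; rewrite ffunE.
Qed.

(** * Degree bounds *)

(** The list holds the treated edges, latest first. Before any stage all maps are candidates, and
    the base case counts those with prescribed values on [K]. *)
Fixpoint degree_bound (R : realType) (T : finType) (b q : nat)
    (l : seq {set T}) (K : {set T}) : R :=
  if l is e :: l' then
    #|{set T}|%:R * degree_bound R b q l' K / b%:R + degree_bound R b q l' (K :|: e)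
  else q%:R ^+ (#|T| - #|K|).

Lemma degree_bound_gt0 (R : realType) (T : finType) b q (l : seq {set T}) K :
  (0 < b)%N -> (0 < q)%N -> 0 < degree_bound R b q l K.
Proof.
move=> b0 q0; elim: l K => [|e l IH] K /=; first by rewrite exprn_gt0 ?ltr0n.
by rewrite addr_gt0// divr_gt0 ?ltr0n// mulr_gt0// ltr0n; apply/card_gt0P; exists set0.
Qed.

(** Generalizing from one edge to a set [S] makes the recursion close: each listed edge is either
    skipped, its factor $b$ cancelling the division, or absorbed into [S]. The two branches give the
    factor $2^{v(H)}+1$ per edge, and the density hypothesis settles the leaves. *)
Lemma degree_bound_le (R : realType) (T : finType) b q (delta : R)
    (l : seq {set T}) (S : {set {set T}}) :
  (0 < b)%N -> (0 < q)%N -> uniq l -> S != set0 -> (forall e, e \in l -> e \notin S) ->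
  (forall S' : {set {set T}}, S' != set0 -> S' \subset S :|: [set e in l] ->
     b%:R ^+ #|S'| <= delta * q%:R ^+ #|cover S'|) ->
  b%:R ^+ (#|S| + size l) * degree_bound R b q l (cover S)
    <= (#|{set T}|%:R + 1) ^+ size l * delta * q%:R ^+ #|T|.
Proof.
move=> b0 q0; elim: l S => [|e l IH] S /= ul S0 lS dens.
  rewrite addn0 expr0 mul1r.
  have -> : q%:R ^+ #|T| = q%:R ^+ #|cover S| * q%:R ^+ (#|T| - #|cover S|) :> R.
    by rewrite -exprD subnKC ?max_card.
  by rewrite mulrA ler_wpM2r ?exprn_ge0// dens ?subsetUl.
case/andP: ul => el ul; have eS := lS e (mem_head _ _).
have b0R : b%:R != 0 :> R by rewrite pnatr_eq0 -lt0n.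
have IH1 := IH S ul S0 _ _.
have IH2 := IH (e |: S) ul _ _ _.
have c2 : #|e |: S| = #|S|.+1 by rewrite cardsU1 eS.
have cov : cover (e |: S) = cover S :|: e.
  by rewrite /cover big_setU1//= setUC.
rewrite c2 cov in IH2.
set X := b%:R ^+ _; set D1 := degree_bound _ _ _ _ (cover S); set D2 := degree_bound _ _ _ _ _.
have -> : X * (#|{set T}|%:R * D1 / b%:R + D2) =
   #|{set T}|%:R * (b%:R ^+ (#|S| + size l) * D1) + b%:R ^+ (#|S|.+1 + size l) * D2.
  rewrite /X addnS addSn exprS.
  (* [field] would try to evaluate the cardinal of [{set T}]. *)
  have fieldE (t y x z u : R) : t != 0 -> t * y * (x * z / t + u) = x * (y * z) + t * y * u.
    by move=> t0; field.
  exact: fieldE.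
rewrite exprS -!mulrA mulrDl mul1r; apply: lerD.
  rewrite ler_wpM2l// !mulrA; apply: IH1 => [f fl|S' S'0 S'S].
    by rewrite lS// inE fl orbT.
  apply: dens => //; apply: subset_trans S'S _; apply: setUS.
  by apply/subsetP=> f; rewrite !inE => ->; rewrite orbT.
rewrite !mulrA; apply: IH2 => [|f fl|S' S'0 S'S].
- by apply/set0Pn; exists e; rewrite !inE eqxx.
- rewrite !inE negb_or lS ?inE ?fl ?orbT// andbT.
  by apply: contra el => /eqP<-.
- apply: dens => //; apply: subset_trans S'S _.
  by apply/subsetP=> f; rewrite !inE => /orP[/orP[]|]->; rewrite ?orbT.
Qed.

(** * All stages in succession *)

(** The tail of [l] is treated first, and each stage costs a factor $4b$. Pairs of untreated edges
    stay unoffered by [embed_eq]. *)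
Lemma forces_family (R : realType) (T : finType) (E : {set {set T}}) (b q n : nat)
    (iota : T * 'I_q -> 'I_n) (l : seq {set T}) :
  simple_graph E -> injective iota -> (0 < b)%N -> (0 < q)%N -> uniq l ->
  {subset l <= E} ->
  (forall e l', uniq (e :: l') -> {subset e :: l' <= E} ->
    2 * b%:R * (4 * b%:R) ^+ size l' * degree_bound R b q l' e <= q%:R ^+ #|T|) ->
  @forces b n (fun h =>
    (forall e phi, e \in E -> e \notin l -> embed iota phi e \in unoffered h) /\
    exists F : {set {ffun T -> 'I_q}},
      [/\ forall phi e, phi \in F -> e \in l -> embed iota phi e \in client_graph h,
          forall K phi, #|[set psi in F | agree K phi psi]|%:R <= degree_bound R b q l K &
          q%:R ^+ #|T| <= (4 * b%:R) ^+ size l * #|F|%:R :> R]) [::].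
Proof.
move=> sE iinj b0 q0 + + dens; elim: l => [_ _|e l IH /= ul lE].
  apply: forces_now; split.
    move=> e phi eE _; rewrite /unoffered big_nil setD0 inE card_embed//.
    by move/forall_inP: sE; apply.
  exists setT; split=> //.
    move=> K phi /=; rewrite -natrX ler_nat.
    have -> : [set psi in [set: {ffun T -> 'I_q}] | agree K phi psi] = [set psi | agree K phi psi].
      by apply/setP=> psi; rewrite !inE.
    by rewrite card_agree card_ord.
  by rewrite expr0 mul1r cardsT card_ffun card_ord natrX.
have [el ull] := andP ul.
have eE : e \in E by apply: lE; rewrite mem_head.
have lE' : {subset l <= E} by move=> f fl; apply: lE; rewrite inE fl orbT.
apply: (forces_trans (IH ull lE')) => h [unh [F [Fcl degF Fq]]].
have b0R : 0 < b%:R :> R by rewrite ltr0n.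
(* Candidates mapping [e] to the same pair agree on [e], which enlarges [K] to [K :|: e]. *)
have degF' K phi f : #|[set psi in F | agree K phi psi && (embed iota psi e == f)]|%:R
    <= degree_bound R b q l (K :|: e).
  have [->|[psi]] := set_0Vmem [set psi in F | agree K phi psi && (embed iota psi e == f)].
    by rewrite cards0 ltW// degree_bound_gt0.
  rewrite inE => /and3P[Fpsi pa /eqP pe].
  apply: le_trans (degF (K :|: e) psi); rewrite ler_nat subset_leq_card//.
  apply/subsetP=> chi; rewrite !inE => /and3P[-> ca /eqP ce] /=.
  apply/agreeP=> t; rewrite inE => /orP[tK|te].
    by rewrite -(agreeP _ _ _ pa t tK) -(agreeP _ _ _ ca t tK).
  have /(embed_eq iinj)[_ /agreeP] : embed iota psi e = embed iota chi e by rewrite pe ce.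
  exact.
have degM f : #|[set psi in F | embed iota psi e == f]|%:R <= degree_bound R b q l e.
  have [->|[psi]] := set_0Vmem [set psi in F | embed iota psi e == f].
    by rewrite cards0 ltW// degree_bound_gt0.
  move=> _; have := degF' set0 psi f; rewrite set0U; apply: le_trans.
  rewrite ler_nat subset_leq_card//.
  apply/subsetP=> chi; rewrite !inE => /andP[-> ->]; rewrite andbT /=.
  by apply/agreeP=> t; rewrite inE.
pose O := [set embed iota phi e | phi : {ffun T -> 'I_q}].
have stage := @forces_stage R b n _ _ (@agree T 'I_q) (degree_bound R b q l)
   (fun K => degree_bound R b q l (K :|: e)) (degree_bound R b q l e) F
   (fun phi => embed iota phi e) O h b0 (@agree_sym T _) (@agree_left_transitive T _)
   (fun K => degree_bound_gt0 R l K b0 q0) degF (fun K => ltW (degree_bound_gt0 R l _ b0 q0))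
   degF' degM _ _.
apply: (forces_trans (stage _ _)).
- by apply/subsetP=> _ /imsetP[phi _ ->]; apply: unh.
- by move=> phi; apply: imset_f.
move=> h' [clh unh' [A [AF Acl degA FA]]]; apply: forces_now; split.
  move=> f phi fE; rewrite inE negb_or => /andP[fe fl].
  apply: (subsetP unh'); apply/setDP; split; first exact: unh.
  by apply/imsetP=> -[psi _ /(embed_eq iinj)[fe' _]]; rewrite fe' eqxx in fe.
exists A; split=> //.
  move=> phi f Aphi; rewrite inE => /orP[/eqP->|fl]; first exact: Acl.
  by apply: (subsetP clh); apply: Fcl => //; apply: (subsetP AF).
apply: (le_trans Fq) => /=; rewrite exprS.
have := dens e l ul lE => de.
have p0 : 0 < (4 * b%:R : R) ^+ size l by rewrite exprn_gt0// mulr_gt0.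
rewrite -[4 * b%:R * _]mulrC -mulrA ler_pM2l//.
(* The first-pick loss is thus at most half of [F], which turns the factor $2b$ of the stage into
   $4b$. *)
have : 2 * b%:R * degree_bound R b q l e <= #|F|%:R.
  rewrite -(ler_pM2l p0); apply: le_trans Fq; apply: le_trans de.
  by rewrite mulrA [X in X * _ <= _]mulrC.
lra.
Qed.

(** * Density and the choice of constants *)

(** The subgraph [(cover S, S)] gives $|S|/m(H) \le |cover(S)|$. Since [S] is nonempty and $c\le 1$,
    also $c^{|S|}\le c$. *)
Lemma expr_le_of_density (R : realType) (T : finType) (E S : {set {set T}})
    (b n : nat) (c : R) :
  simple_graph E -> (0 < n)%N -> 0 <= c <= 1 -> S != set0 -> S \subset E ->
  b%:R <= c * n%:R `^ (1 / max_density R E) ->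
  b%:R ^+ #|S| <= c * n%:R ^+ #|cover S|.
Proof.
move=> sE n0 /andP[c0 c1] S0 SE bc.
have [e eS] := set0Pn _ S0.
have S1 : (0 < #|S|)%N by rewrite card_gt0.
have V1 : (0 < #|cover S|)%N.
  apply: leq_trans (subset_leq_card (bigcup_sup e eS)).
  by have /forall_inP/(_ _ (subsetP SE _ eS))/eqP-> := sE.
have mS : #|S|%:R / #|cover S|%:R <= max_density R E.
  rewrite /max_density.
  apply: (@le_bigmax_cond _ R _ 0 (cover S, S) _ (fun S => #|S.2|%:R / #|S.1|%:R)).
  rewrite /subgraph /= SE V1 andbT; apply/forall_inP => f fS.
  exact: bigcup_sup.
have m0 : 0 < max_density R E by apply: lt_le_trans mS; rewrite divr_gt0 ?ltr0n.
apply: le_trans (_ : (c * n%:R `^ (1 / max_density R E)) ^+ #|S| <= _).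
  by apply: lerXn2r; rewrite // nnegrE ?mulr_ge0 ?powR_ge0.
rewrite exprMn; apply: ler_pM; rewrite ?exprn_ge0 ?powR_ge0//.
  by rewrite -[X in _ <= X]expr1 ler_wiXn2l.
rewrite -!powR_mulrn ?powR_ge0// -powRrM ler_powR ?ler1n//.
rewrite div1r mulrC ler_pdivrMr//.
by move: mS; rewrite ler_pdivrMr ?ltr0n// mulrC.
Qed.

Theorem mainTheorem1 (R : realType) (T : finType) (E : {set {set T}})
    (simpleE : simple_graph E) (E_gt0 : (1 <= #|E|)%N) :
  exists c gamma : R, 0 < c /\ 0 < gamma /\
    exists n0 : nat, forall n b : nat, (n0 <= n)%N -> (1 <= b)%N ->
      b%:R <= c * n%:R `^ (1 / max_density R E) ->
      @waiter_ensures b n (fun G : {set {set 'I_n}} =>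
        gamma * n%:R ^+ #|T| / b%:R ^+ #|E| <= (copies E G)%:R).
Proof.
have T0 : (0 < #|T|)%N.
  have /card_gt0P[e eE] := E_gt0.
  have /forall_inP/(_ e eE)/eqP e2 := simpleE.
  by apply: leq_trans (max_card e); rewrite e2.
(* Chosen so that $n \le vq$ for $q = \lfloor n/|T| \rfloor \ge 1$. *)
pose v : R := 2 * #|T|%:R.
have v1 : 1 <= v by rewrite /v -natrM ler1n muln_gt0.
have v0 : 0 < v by apply: lt_le_trans v1.
(* Loss per edge: 4 from a stage, the other factor from [degree_bound_le]. *)
pose K : R := 4 * (#|{set T}|%:R + 1).
have K1 : 1 <= K.
  have : 0 <= #|{set T}|%:R :> R by [].
  by rewrite /K; move: (#|{set T}|%:R : R) => x; lra.
have K0 : 0 < K by apply: lt_le_trans K1.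
have z0 : 0 < v ^+ #|T| * (2 * K ^+ #|E|) by rewrite !mulr_gt0 ?exprn_gt0.
(* The first constant makes the stage condition of [forces_family] hold. The second absorbs the
   passage from $q$ to $n$ and the factor 4 of each stage. *)
exists (v ^+ #|T| * (2 * K ^+ #|E|))^-1, (v ^+ #|T| * 4 ^+ #|E|)^-1.
set c := (v ^+ _ * (2 * _))^-1.
have c0 : 0 < c by rewrite invr_gt0.
have c1 : c <= 1.
  rewrite invf_le1// mulr_ege1 ?exprn_ege1// mulr_ege1 ?exprn_ege1//.
  by rewrite ler1n.
split=> //; split; first by rewrite invr_gt0 mulr_gt0 ?exprn_gt0.
exists #|T| => n b Tn b0 bc.
have n0 : (0 < n)%N by apply: leq_trans Tn.
pose q := (n %/ #|T|)%N.
have q0 : (0 < q)%N by rewrite divn_gt0.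
have nq : n%:R <= v * q%:R :> R.
  rewrite /v -!natrM ler_nat [X in (X <= _)%N](divn_eq n #|T|) -/q.
  rewrite -mulnA mul2n -addnn [(#|T| * q)%N]mulnC leq_add2l.
  by apply: leq_trans (ltnW (ltn_pmod _ T0)) _; rewrite leq_pmull.
have le_qn : (#|{: T * 'I_q}| <= n)%N.
  by rewrite card_prod card_ord mulnC leq_trunc_div.
pose iota (p : T * 'I_q) : 'I_n := widen_ord le_qn (enum_rank p).
have iinj : injective iota.
  by move=> x y /(congr1 val) /= /val_inj/enum_rank_inj.
have b0R : 0 < b%:R :> R by rewrite ltr0n.
(* Replacing $n$ by $q$ costs $v^{|cover(S)|}$, at most $v^{|T|}$ as $v\ge 1$. *)
have dens (S : {set {set T}}) : S != set0 -> S \subset E ->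
    b%:R ^+ #|S| <= c * v ^+ #|T| * q%:R ^+ #|cover S|.
  move=> S0 SE; apply: le_trans (expr_le_of_density simpleE n0 _ S0 SE bc) _.
    by rewrite (ltW c0).
  rewrite -mulrA ler_wpM2l ?(ltW c0)//.
  apply: le_trans (_ : (v * q%:R) ^+ #|cover S| <= _).
    by apply: lerXn2r; rewrite // nnegrE ?mulr_ge0// ltW.
  by rewrite exprMn ler_wpM2r ?exprn_ge0// ler_weXn2l// max_card.
have family := forces_family (R := R) (n := n) (iota := iota) (b := b)
  (l := enum E) simpleE iinj b0 q0 (enum_uniq _) _ _.
apply: forces_ensures; apply: (forces_trans (family _ _)) => [f|e l ul lE|h [_]].
- by rewrite mem_enum.
- have [el ull] := andP ul.
  have := @degree_bound_le R T b q (c * v ^+ #|T|) l [set e] b0 q0 ull _ _ _.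
  rewrite cards1 /cover big_set1 add1n exprS => bd.
  have sl : (size l <= #|E|)%N.
    rewrite cardE; apply: uniq_leq_size ull _ => f fl.
    by rewrite mem_enum lE// inE fl orbT.
  have : b%:R * b%:R ^+ size l * degree_bound R b q l e
      <= (#|{set T}|%:R + 1) ^+ size l * (c * v ^+ #|T|) * q%:R ^+ #|T|.
    apply: bd => [|f fl|S S0 Sl].
    + by apply/set0Pn; exists e; rewrite inE.
    + by rewrite inE; apply: contra el => /eqP<-.
    + apply: dens => //; apply: subset_trans Sl _; apply/subsetP=> f.
      by rewrite !inE => fe; apply: lE; rewrite inE.
  move=> {}bd.
  have kk : 2 * 4 ^+ size l * ((#|{set T}|%:R + 1) ^+ size l * (c * v ^+ #|T|)) <= 1.
    rewrite mulrA -[2 * _ * _]mulrA -exprMn -/K.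
    have -> : c * v ^+ #|T| = (2 * K ^+ #|E|)^-1.
      by rewrite /c invfM mulrAC mulVf ?mul1r// expf_neq0// gt_eqF.
    rewrite ler_pdivrMr ?mulr_gt0 ?exprn_gt0// mul1r.
    by rewrite ler_pM2l// ler_weXn2l.
  apply: le_trans (_ : 2 * 4 ^+ size l *
    ((#|{set T}|%:R + 1) ^+ size l * (c * v ^+ #|T|)) * q%:R ^+ #|T| <= _).
    rewrite -[X in _ <= X]mulrA exprMn.
    rewrite [X in X <= _](_ : _ = 2 * 4 ^+ size l *
        (b%:R * b%:R ^+ size l * degree_bound R b q l e)).
      by rewrite ler_wpM2l// mulr_ge0// exprn_ge0.
    by move: (degree_bound _ _ _ _ _) => x; ring.
  by rewrite -[X in _ <= X]mul1r ler_wpM2r ?exprn_ge0.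
case=> F [Fcl _ Fq].
have FE phi e : phi \in F -> e \in E -> embed iota phi e \in client_graph h.
  by move=> Fphi eE; apply: Fcl; rewrite ?mem_enum.
apply: (@forces_finish b n (fun G : {set {set 'I_n}} =>
  _ / b%:R ^+ #|E| <= (copies E G)%:R)) => //.
  move=> G G' GG' /le_trans; apply; rewrite ler_nat subset_leq_card//.
  apply/subsetP=> S; rewrite !inE /subgraph => /andP[/andP[/subset_trans->//]].
  by move=> -> ->.
apply: le_trans (_ : #|F|%:R <= _); last by rewrite ler_nat (leq_copies iinj FE).
rewrite ler_pdivrMr ?exprn_gt0// mulrC ler_pdivrMr ?mulr_gt0 ?exprn_gt0//.
move: Fq; rewrite -cardE exprMn => Fq.
apply: le_trans (_ : (v * q%:R) ^+ #|T| <= _).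
  by apply: lerXn2r; rewrite // nnegrE ?mulr_ge0// ltW.
rewrite exprMn mulrCA ler_pM2l ?exprn_gt0//; apply: le_trans Fq _.
by rewrite mulrC -mulrA [_ * 4 ^+ _]mulrC.
Qed.
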